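(* There exists a Borel injection $\Psi\colon \mathrm{SB}\to \mathrm{SF}$ such that $\Psi(X)\cong X$ for all $X\in\mathrm{SB}$. In particular, if $\mathcal{P}$ is a class of separable Banach spaces and $$\mathrm{P}=\{X\in\mathrm{SB}\mid X\in\mathcal{P}\}\quad\text{and}\quad \mathrm{P}_{\mathrm F}=\{X\in \mathrm{SF}\mid X\in\mathcal{P}\},$$ then the complexity of $\mathrm{P}_{\mathrm F}$ in $\mathrm{SF}$ is the same as the complexity of $\mathrm{P}$ in $\mathrm{SB}$; that is, for every $n\in\mathbb{N}$, $\mathrm{P}$ is $\Sigma^1_n$ (resp. $\Pi^1_n$, $\Delta^1_n$) in $\mathrm{SB}$ if and only if $\mathrm{P}_{\mathrm F}$ is $\Sigma^1_n$ (resp. $\Pi^1_n$, $\Delta^1_n$) in $\mathrm{SF}$.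
   Context: $\mathbb{N}=\{1,2,\dots\}$. A Fréchet space is a completely metrizable locally convex topological vector space (real scalars) whose topology can be defined by an invariant metric. $\cong$ denotes linear isomorphism (linear homeomorphism). $C(\Delta)$ is the Banach space of continuous real-valued functions on the Cantor set $\Delta$. $C(\mathbb{R})$ is the Fréchet space of continuous real-valued functions on $\mathbb{R}$ with the topology of uniform convergence on compact sets; every separable Fréchet space is isomorphic to a closed subspace of it. $\mathrm{SB}=\{X\subseteq C(\Delta)\mid X\text{ is a closed vector subspace}\}$ and $\mathrm{SF}=\{X\subseteq C(\mathbb{R})\mid X\text{ is a closed vector subspace}\}$, each with the Effros Borel structure, i.e., the $\sigma$-algebra generated by the sets $\{X\mid X\cap U\neq\emptyset\}$, where $U$ ranges over the open subsets of $C(\Delta)$, respectively $C(\mathbb{R})$. Both are standard Borel spaces. A class $\mathcal{P}$ of separable Banach spaces always means one closed under isomorphism: if $X\cong Y$ and $X\in\mathcal{P}$, then $Y\in\mathcal{P}$. For $X\in\mathrm{SF}$, ''$X\in\mathcal{P}$'' means that $X$ is normable (its topology is generated by a norm) and, as a Banach space, $X$ belongs to $\mathcal{P}$. *)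

(* Defs.v *)
From HB Require Import structures.
From mathcomp Require Import all_boot all_order all_algebra.
From mathcomp Require Import all_classical all_reals all_analysis.
From mathcomp Require Import lra.

Set Implicit Arguments.
Unset Strict Implicit.
Unset Printing Implicit Defensive.

Import Order.TTheory GRing.Theory Num.Theory.
Import numFieldNormedType.Exports.

Local Open Scope classical_set_scope.
Local Open Scope ring_scope.

Section ContinuousLmodule.
Context {T : topologicalType} {R : realType}.

Definition ctsfun : {pred T -> R} := mem [set f : T -> R | continuous f].

Section Sub.
Context (f : T -> R) (fP : f \in ctsfun).
Definition cts_Sub_subproof := @isContinuous.Build T R f (set_mem fP).
#[local] HB.instance Definition _ := cts_Sub_subproof.
Definition cts_Sub : continuousType T R := f.
End Sub.

Lemma cts_rect (K : continuousType T R -> Type) :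
  (forall f (Pf : f \in ctsfun), K (cts_Sub Pf)) -> forall u, K u.
Proof.
move=> Ksub [f [[Pf]]]/=.
by suff -> : Pf = (set_mem (@mem_set _ [set f | _] f Pf)) by apply: Ksub.
Qed.

Lemma cts_valP f (Pf : f \in ctsfun) : cts_Sub Pf = f :> (_ -> _).
Proof. by []. Qed.

HB.instance Definition _ := isSub.Build _ _ (continuousType T R) cts_rect cts_valP.

Lemma ctsfun_submod_closed : submod_closed ctsfun.
Proof.
split=> [|a f g]; rewrite !inE /=; first by move=> x; exact: cvg_cst.
by move=> cf cg x; apply: cvgD; [apply: cvgMl_tmp; exact: cf|exact: cg].
Qed.

HB.instance Definition _ :=
  GRing.isSubmodClosed.Build _ _ ctsfun ctsfun_submod_closed.

HB.instance Definition _ :=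
  [SubChoice_isSubLmodule of continuousType T R by <:].
End ContinuousLmodule.

Definition C_cantor (R : realType) : Type := continuousType cantor_space R.

HB.instance Definition _ (R : realType) := GRing.Lmodule.on (C_cantor R).

Section CantorSupNorm.
Context {R : realType}.
Implicit Types f g : C_cantor R.

Definition sup_norm f : R := sup (range (fun x : cantor_space => `|f x|)).

Lemma has_sup_norm f : has_sup (range (fun x : cantor_space => `|f x|)).
Proof.
split; first by exists `|f point|; exists point.
have : compact (range (fun x : cantor_space => `|f x|)).
  apply: (@continuous_compact cantor_space R); last exact: cantor_space_compact.
  apply: continuous_subspaceT => x; apply: continuous_comp; first exact: cts_fun.
  exact: norm_continuous.
move=> /compact_bounded[M [_ /(_ (M + 1))]].
have M1 : M < M + 1 by rewrite ltrDl.
move=> /(_ M1) h; exists (M + 1) => _ [x _ <-].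
have /= := h _ (ex_intro2 _ _ x I erefl).
by rewrite normr_id.
Qed.

Lemma sup_norm_ub f x : `|f x| <= sup_norm f.
Proof. by apply: sup_ubound; [have [] := has_sup_norm f|exists x]. Qed.

Lemma sup_norm_le f c : (forall x, `|f x| <= c) -> sup_norm f <= c.
Proof.
move=> fc; apply: ge_sup; first by have [] := has_sup_norm f.
by move=> _ [x _ <-].
Qed.

Lemma sup_normD f g : sup_norm (f + g) <= sup_norm f + sup_norm g.
Proof.
apply: sup_norm_le => x; apply: le_trans (ler_normD _ _) _.
by apply: lerD; exact: sup_norm_ub.
Qed.

Lemma sup_norm_leZ (a : R) f : sup_norm (a *: f) <= `|a| * sup_norm f.
Proof.
by apply: sup_norm_le => x; rewrite normrM ler_wpM2l// sup_norm_ub.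
Qed.

Lemma sup_normZ (a : R) f : sup_norm (a *: f) = `|a| * sup_norm f.
Proof.
apply/eqP; rewrite eq_le sup_norm_leZ /=.
have [->|a0] := eqVneq a 0.
  by rewrite normr0 mul0r; apply: le_trans (sup_norm_ub _ point).
have {1}-> : f = a^-1 *: (a *: f) by rewrite scalerA mulVf// scale1r.
rewrite -ler_pdivlMl ?normr_gt0// -normfV; exact: sup_norm_leZ.
Qed.

Lemma sup_norm_eq0 f : sup_norm f = 0 -> f = 0.
Proof.
move=> f0; apply/continuousEP => x; apply/eqP; rewrite -normr_le0 -f0.
exact: sup_norm_ub.
Qed.

HB.instance Definition _ :=
  Lmodule_isNormed.Build R (C_cantor R) sup_normD sup_normZ sup_norm_eq0.

End CantorSupNorm.

(* C(R) as a space of its own: same functions as [continuousType R R], with the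
   topology of uniform convergence on compact sets. *)
Definition C_line (R : realType) : Type := continuousType R R.

HB.instance Definition _ (R : realType) := GRing.Lmodule.on (C_line R).
HB.instance Definition _ (R : realType) := Uniform.copy (C_line R)
  (initial_topology (fun f : C_line R => (f : {family compact, R -> R}))).

Record closed_subspace (R : realType) (E : preTopologicalLmodType R) :=
  ClosedSubspace {
    csub_set :> set E;
    csub_closed : closed csub_set;
    csub_submod : submod_closed [in csub_set] }.

Definition csub (R : realType) (E : preTopologicalLmodType R)
  (X : closed_subspace E) : Type := set_type X.

Section Csub.
Context {R : realType} {E : preTopologicalLmodType R} (X : closed_subspace E).

Definition csub_pred : {pred E} := [in csub_set X].
HB.instance Definition _ :=
  GRing.isSubmodClosed.Build _ _ csub_pred (csub_submod X).

HB.instance Definition _ := SubChoice.copy (csub X) {x | x \in csub_pred}.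
HB.instance Definition _ := [SubChoice_isSubLmodule of csub X by <:].
HB.instance Definition _ := Topological.copy (csub X) (set_type X).
End Csub.

Record vnorm (R : realType) (V : lmodType R) := VNorm {
  vnorm_fun :> V -> R;
  vnormD : forall x y, vnorm_fun (x + y) <= vnorm_fun x + vnorm_fun y;
  vnormZ : forall a x, vnorm_fun (a *: x) = `|a| * vnorm_fun x;
  vnorm0_eq0 : forall x, vnorm_fun x = 0 -> x = 0 }.

(* [normed_by N] is [V] with the topology of the norm [N], forgetting any
   topology [V] may already carry. *)
Definition normed_by (R : realType) (V : lmodType R) (N : vnorm V) : Type := V.

HB.instance Definition _ (R : realType) (V : lmodType R) (N : vnorm V) :=
  GRing.Lmodule.on (normed_by N).
HB.instance Definition _ (R : realType) (V : lmodType R) (N : vnorm V) :=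
  Lmodule_isNormed.Build R (normed_by N) (@vnormD R V N) (@vnormZ R V N)
    (@vnorm0_eq0 R V N).

Definition norm_complete (R : realType) (V : lmodType R) (N : vnorm V) :=
  forall F : set_system (normed_by N), ProperFilter F -> cauchy F -> cvg F.

Definition banach_by (R : realType) (V : lmodType R) (N : vnorm V)
  (cN : norm_complete N) : Type := normed_by N.

HB.instance Definition _ (R : realType) (V : lmodType R) (N : vnorm V)
  (cN : norm_complete N) := NormedModule.on (banach_by cN).
HB.instance Definition _ (R : realType) (V : lmodType R) (N : vnorm V)
  (cN : norm_complete N) := Uniform_isComplete.Build (banach_by cN) cN.

Definition norm_generates (R : realType) (V : preTopologicalLmodType R)
    (N : vnorm V) :=
  forall (x : V) (A : set V), nbhs x A <-> nbhs (x : normed_by N) A.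

(* Completeness for the translation-invariant uniformity of [E]. *)
Definition tvs_complete (R : realType) (E : preTopologicalLmodType R) :=
  forall F : set_system E, ProperFilter F ->
    (forall U, nbhs (0 : E) U -> \forall f & g \near F, U (f - g)) ->
    exists f : E, F --> f.

Section Complete.
Context {R : realType}.

Lemma csub_complete (E : preTopologicalLmodType R) (X : closed_subspace E)
    (N : vnorm (csub X)) :
  tvs_complete E -> norm_generates N -> norm_complete N.
Proof.
move=> cE gN F FF /cauchy_ballP Fc.
pose G : set_system E := (val : csub X -> E) @ F.
have GP : ProperFilter G by exact: fmap_proper_filter.
have valc : continuous (val : csub X -> E) by exact: initial_continuous.
have [|f Gf] := cE G GP.
  move=> U U0.
  have /gN /nbhs_ballP[e /= e0 eU] : nbhs (0 : csub X) (val @^-1` U).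
    by apply: valc; rewrite raddf0.
  rewrite near_map2; have := Fc e e0.
  apply: filterS => -[x y] /= xy; apply: (eU (x - y)).
  have {}xy : N (x - y) < e := xy.
  suff : `|0 - (x - y) : normed_by N| < e by [].
  by rewrite sub0r normrN.
have Xf : f \in csub_pred X.
  rewrite inE; apply: (closed_cvg (csub_set X) _ _ f Gf) => //.
    exact: csub_closed.
  by apply: nearW => x /=; move: (valP x); rewrite inE.
apply/cvg_ex; exists (Sub f Xf : csub X) => A /gN.
case=> B [/= [W oW <-] /= Wf] /filterS; apply.
by apply: Gf; apply: open_nbhs_nbhs; split.
Qed.

Lemma unif_cauchy (S T : Type) (c : S -> T -> R) (F : set_system S)
    (fam : set_system T) : ProperFilter F ->
  (forall x, exists2 K, fam K & K x) ->
  (forall K e, fam K -> 0 < e -> \forall f & g \near F,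
     forall x : T, K x -> `|c f x - c g x| < e) ->
  exists l : T -> R, forall K e, fam K -> 0 < e ->
    \forall f \near F, forall x, K x -> `|l x - c f x| <= e.
Proof.
move=> FF famT Fc.
have cvgx x : exists l : R, c f x @[f --> F] --> l.
  have [K fK Kx] := famT x.
  apply/cvg_ex/(@cauchy_cvg R ((fun f => c f x) @ F)).
  apply/cauchy_ballP => e e0; rewrite near_map2.
  have := Fc K e fK e0; apply: filterS => -[f g] /= fg; exact: fg.
have [l lP] := choice cvgx.
exists l => K e fK e0; have /nearP_dep := Fc K e fK e0.
apply: filterS => f fg x Kx.
apply: (closed_cvg [set y : R | `|y - c f x| <= e] _ _ (l x) (lP x)).
  apply: (@closed_comp R R (fun y => `|y - c f x|) [set y | y <= e]).
    move=> y _; apply: (@cvg_norm _ _ _ (nbhs y)).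
    by apply: cvgB; [exact: cvg_id|exact: cvg_cst].
  exact: closed_le.
by apply: filterS fg => g /(_ x Kx) /ltW; rewrite distrC.
Qed.

Lemma C_cantor_complete : tvs_complete (C_cantor R).
Proof.
move=> F FF Fc.
have [| |l lF] := @unif_cauchy _ _ (fun f : C_cantor R => f : cantor_space -> R)
    F [set setT] FF; first by move=> x; exists setT.
  move=> _ e -> e0; have := Fc _ (nbhsx_ballx 0 e e0).
  apply: filterS => -[f g] /=.
  rewrite -ball_normE /= sub0r normrN => fg x _; apply: le_lt_trans fg.
  exact: (sup_norm_ub (f - g)).
have {}lF e : 0 < e -> \forall f \near F, forall x, `|l x - (f : C_cantor R) x| <= e.
  by move=> e0; have := lF setT e erefl e0; apply: filterS => f lf x; exact: lf.
have lc : continuous l.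
  move=> x; apply/cvgrPdist_le => e e0; near F => f.
  have lf : forall x, `|l x - f x| <= e / 3.
    by near: f; apply: lF; rewrite divr_gt0.
  near=> y.
  have fxy : `|f x - f y| <= e / 3.
    near: y; have /cvgrPdist_le := @cts_fun _ _ f x; apply; by rewrite divr_gt0.
  have lx := lf x; have ly := lf y.
  rewrite !ler_norml in lx ly fxy *; lra.
exists (mkcts lc : C_cantor R); apply/cvgrPdist_le => e e0.
have := lF e e0; apply: filterS => f lf; exact: sup_norm_le.
Unshelve. all: by end_near. Qed.

Let incl (f : C_line R) : {family compact, R -> R} := f.

Lemma C_line_nbhs0 (K : set R) (e : R) : compact K -> 0 < e ->
  nbhs (0 : C_line R) [set f : C_line R | forall x, K x -> `|f x| < e].
Proof.
move=> cK e0.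
have : {family compact, incl @ nbhs (0 : C_line R) --> incl 0}.
  exact: (@initial_continuous _ _ incl).
move=> /fam_cvgP /(_ K cK) h.
have : nbhs (incl 0 : {uniform` K -> R})
    [set h | forall y, K y -> `|incl 0 y - h y| < e].
  rewrite uniform_nbhs; exists [set xy : R * R | `|xy.1 - xy.2| < e]; split=> //.
  by rewrite -entourage_ballE; exists e.
move=> /h {}h; apply: (@filterS _ (nbhs (0 : C_line R)) _ _ _ _ h) => f fK x Kx.
by have := fK x Kx; rewrite /incl sub0r normrN.
Qed.

Lemma C_line_cvg (F : set_system (C_line R)) (f : C_line R) : Filter F ->
  (forall (K : set R) (e : R), compact K -> 0 < e ->
    \forall g \near F, forall x : R, K x -> `|f x - (g : C_line R) x| <= e) ->
  F --> f.
Proof.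
move=> FF Ff A [B [/= [W oW <-] /= Wf] /filterS]; apply.
suff : {family compact, incl @ F --> incl f}.
  by apply; apply: open_nbhs_nbhs; split.
apply/fam_cvgP => K cK U; rewrite uniform_nbhs => -[E [entE] /filterS]; apply.
move: entE; rewrite -entourage_ballE => -[e /= e0 eE].
apply: filterS (Ff K (e / 2) cK _); last by rewrite divr_gt0.
move=> g fg x Kx; apply: eE => /=; rewrite -ball_normE /=.
by apply: le_lt_trans (fg x Kx) _; rewrite ltr_pdivrMr// ltr_pMr// ltr1n.
Qed.

Lemma C_line_complete : tvs_complete (C_line R).
Proof.
move=> F FF Fc.
have [| |l lF] := @unif_cauchy _ _ (fun f : C_line R => f : R -> R)
    F compact FF; first by move=> x; exists [set x]; [exact: compact_set1|].
  move=> K e cK e0; have := Fc _ (C_line_nbhs0 cK e0).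
  by apply: filterS => -[f g] /= fg x; exact: fg.
have lc : continuous l.
  move=> x; apply/cvgrPdist_le => e e0; near F => f.
  have lf : forall y, `[x - 1, x + 1]%classic y -> `|l y - f y| <= e / 3.
    near: f; apply: lF; first exact: segment_compact.
    by rewrite divr_gt0.
  near=> y.
  have fxy : `|f x - f y| <= e / 3.
    near: y; have /cvgrPdist_le := @cts_fun _ _ f x; apply; by rewrite divr_gt0.
  have /lf lx : `[x - 1, x + 1]%classic x.
    by rewrite /= in_itv /=; apply/andP; split; lra.
  have /lf ly : `[x - 1, x + 1]%classic y.
    near: y; apply: filterS (nbhsx_ballx x 1 ltr01) => y.
    rewrite -ball_normE /= ltr_norml in_itv /= => /andP[? ?].
    by apply/andP; split; lra.
  rewrite !ler_norml in lx ly fxy *; lra.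
exists (mkcts lc : C_line R); apply: C_line_cvg => K e cK e0.
exact: lF.
Unshelve. all: by end_near. Qed.
End Complete.

Section SubNorm.
Context {R : realType} {E : normedModType R} (X : closed_subspace E).

Let nrm (x : csub X) : R := `|val x|.

Let nrmD x y : nrm (x + y) <= nrm x + nrm y.
Proof. exact: ler_normD. Qed.

Let nrmZ (a : R) x : nrm (a *: x) = `|a| * nrm x.
Proof. exact: normrZ. Qed.

Let nrm0_eq0 x : nrm x = 0 -> x = 0.
Proof. by move=> /normr0_eq0 x0; exact: val_inj. Qed.

Definition sub_norm : vnorm (csub X) := VNorm nrmD nrmZ nrm0_eq0.

Lemma sub_norm_generates : norm_generates sub_norm.
Proof.
move=> x A; split.
  case=> B [/= [W oW <-] /= Wx] WA.
  have /nbhs_ballP[e /= e0 eW] : nbhs (val x) W by exact: open_nbhs_nbhs.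
  apply/(@nbhs_ballP R (normed_by sub_norm)); exists e => //= y xy.
  by apply/WA/eW; rewrite -ball_normE.
move=> /(@nbhs_ballP R (normed_by sub_norm))[e /= e0 eA].
have : nbhs x (val @^-1` ball (val x) e).
  by apply: (@initial_continuous _ _ (val : csub X -> E)); exact: nbhsx_ballx.
by apply: filterS => y /=; rewrite -ball_normE => xy; exact: eA.
Qed.
End SubNorm.
Arguments sub_norm_generates {R E} X.

Section Effros.
Context {R : realType} {E : preTopologicalLmodType R}.

Definition effros_gen : set_system (closed_subspace E) :=
  [set [set X : closed_subspace E | csub_set X `&` U !=set0] | U in open].

Let full_submod : submod_closed [in [set: E]].
Proof. by split=> [|a f g _ _]; rewrite inE. Qed.

HB.instance Definition _ := gen_eqMixin (closed_subspace E).
HB.instance Definition _ := gen_choiceMixin (closed_subspace E).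
(* Measurable types are pointed; the choice of the point is immaterial. *)
HB.instance Definition _ :=
  isPointed.Build (closed_subspace E) (ClosedSubspace closedT full_submod).
HB.instance Definition _ :=
  Measurable.copy (closed_subspace E) (g_sigma_algebraType effros_gen).
End Effros.

Notation SB R := (closed_subspace (C_cantor R)).
Notation SF R := (closed_subspace (C_line R)).

Definition isomorphic (R : realType) (U V : preTopologicalLmodType R) :=
  exists (f : {linear U -> V}) (g : V -> U),
    [/\ cancel f g, cancel g f, continuous f & continuous g].

Definition separable (T : topologicalType) :=
  exists2 D : set T, countable D & dense D.

Definition banach_class (R : realType) (P : completeNormedModType R -> Prop) :=
  (forall X, P X -> separable X) /\
  (forall X Y : completeNormedModType R, isomorphic X Y -> P X -> P Y).

(* A closed subspace of C(Delta) is a Banach space for the sup norm. *)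
Definition class_SB (R : realType) (P : completeNormedModType R -> Prop) :
    set (SB R) :=
  [set X | P (banach_by
     (csub_complete C_cantor_complete (sub_norm_generates X)))].

(* [X] is normable, and is in the class as a Banach space for a norm generating
   its topology. The class being closed under isomorphism, the choice of the norm
   is irrelevant. *)
Definition class_SF (R : realType) (P : completeNormedModType R -> Prop) :
    set (SF R) :=
  [set X | exists (N : vnorm (csub X)) (gN : norm_generates N),
     P (banach_by (csub_complete C_line_complete gN))].

Definition baire_space : Type := prod_topology (fun _ : nat => nat).

HB.instance Definition _ := Pointed.on baire_space.
HB.instance Definition _ := Topological.on baire_space.

Definition baire_borel := g_sigma_algebraType (@open baire_space).
HB.instance Definition _ := Measurable.on baire_borel.

(* Projective hierarchy, for [T] standard Borel: a set is Sigma^1_1 if it is the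
   projection of a Borel subset of T x N^N, and Sigma^1_{m+1} if it is the
   projection of a Pi^1_m subset of T x N^N. The hierarchy starts at index 1; the
   value at 0 is the Borel sets, so that both cases are one recursion step. *)
Fixpoint Sigma1 (n : nat) d (T : measurableType d) (A : set T) : Prop :=
  match n with
  | 0 => measurable A
  | m.+1 => exists2 B : set (T * baire_borel), Sigma1 m (~` B) & A = fst @` B
  end.

Definition Pi1 (n : nat) d (T : measurableType d) (A : set T) : Prop :=
  Sigma1 n (~` A).

Definition Delta1 (n : nat) d (T : measurableType d) (A : set T) : Prop :=
  Sigma1 n A /\ Pi1 n A.

(* Main.v *)
Require Import Defs.
From HB Require Import structures.
From mathcomp Require Import all_boot all_order all_algebra.
From mathcomp Require Import all_classical all_reals all_analysis.
From mathcomp Require Import ring lra.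

Set Implicit Arguments.
Unset Strict Implicit.
Unset Printing Implicit Defensive.

Import Order.TTheory GRing.Theory Num.Theory.
Import numFieldNormedType.Exports.

Local Open Scope classical_set_scope.
Local Open Scope ring_scope.

(** Both reductions between [SB] and [SF] take a closed subspace to the closure
    of its image under a continuous linear operator [L] ([push]).  Such a map is
    Borel whatever [L] is, since the closure of [L @` X] meets an open set [U]
    exactly when [X] meets the open set [L @^-1` U] ([measurable_push]).  When
    [L] is bounded below on [X] and the source is complete, [L @` X] is already
    closed and [L] restricts to an isomorphism ([push_isomorphic]).

    From [SB] to [SF], take for [L] the isometric extension operator [extend],
    which extends a function on the middle-thirds Cantor set piecewise linearly
    to the line.  It is injective and bounded below, so [to_SF := push extend]
    is the Borel injection sought.

    From [SF] to [SB], a continuous map of the Cantor space onto [-k, k] turns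
    restriction to that segment into an operator [restr k] from C(R) to
    C(Delta), with [`|restr k f|] the supremum of [`|f|] over [-k, k].  A
    closed subspace [X] of C(R) is normable exactly when one of these seminorms
    dominates all the others on [X]: a norm generating the topology is dominated
    by some [`|restr k _|] and dominates all of them ([normable_segment]).
    Domination of [`|restr m f|] by [c * `|restr k f|] on [X] says that [X]
    misses the open set where it fails, so the subspaces for which a given [k]
    works form a Borel set.  On them [restr k] is bounded below, and gluing the
    maps [push (restr k)] along a Borel partition gives a Borel map [to_SB] with
    [to_SB X] isomorphic to [X] for every normable [X].

    A class [P] closed under isomorphism therefore satisfies
    [class_SB P = to_SF @^-1` class_SF P] and
    [class_SF P = to_SB @^-1` class_SB P `&` normable], and every level of the
    projective hierarchy is stable under Borel preimages and under intersection
    with a Borel set. *)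

(** * Isomorphisms of normed spaces *)

Section Isomorphism.
Context {R : realType}.

Lemma isomorphic_sym (U V : preTopologicalLmodType R) :
  isomorphic U V -> isomorphic V U.
Proof.
move=> [f [g [fK gK fc gc]]].
have gl : linear g by move=> a x y; apply: (can_inj fK); rewrite linearP !gK.
pose gL := GRing.isLinear.Build R V U *:%R g gl.
pose g' : {linear V -> U} := HB.pack g gL.
by exists g', f.
Qed.

Lemma isomorphic_trans (U V W : preTopologicalLmodType R) :
  isomorphic U V -> isomorphic V W -> isomorphic U W.
Proof.
move=> [f [g [fK gK fc gc]]] [f' [g' [fK' gK' fc' gc']]].
exists (f' \o f : {linear U -> W}), (g \o g'); split.
- exact: can_comp.
- exact: can_comp.
- by move=> x; apply: continuous_comp; [exact: fc|exact: fc'].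
- by move=> x; apply: continuous_comp; [exact: gc'|exact: gc].
Qed.

Lemma normed_by_isomorphic (V : preTopologicalLmodType R) (N : vnorm V) :
  norm_generates N -> isomorphic (normed_by N) V.
Proof.
move=> gN.
have fl : linear (fun x : normed_by N => x : V) by [].
pose fL := GRing.isLinear.Build R (normed_by N) V *:%R _ fl.
pose f : {linear normed_by N -> V} := HB.pack (fun x : normed_by N => x : V) fL.
by exists f, (fun x : V => x : normed_by N); split=> // x A /gN.
Qed.

Lemma normed_by_nbhs0 (V : lmodType R) (N : vnorm V) (A : set V) :
  nbhs (0 : normed_by N) A <-> exists2 e, 0 < e & forall x, N x < e -> A x.
Proof.
have B0 (e : R) (x : V) : ball (0 : normed_by N) e x <-> N x < e.
  rewrite -ball_normE /= sub0r.
  suff -> : `|- (x : normed_by N)| = N x by [].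
  by rewrite normrN.
split; last by case=> e e0 eA; apply/nbhs_ballP; exists e => // x /B0; exact: eA.
by case/nbhs_ballP => e /= e0 eA; exists e => // x /B0; exact: eA.
Qed.

(** Pull the norm back along the isomorphism: normability is an isomorphism
    invariant. *)
Lemma transport_norm (U V : preTopologicalLmodType R) (N : vnorm V) :
  norm_generates N -> isomorphic U V -> exists M : vnorm U, norm_generates M.
Proof.
move=> gN [f [g [fK gK fc gc]]].
have MD x y : N (f (x + y)) <= N (f x) + N (f y) by rewrite linearD vnormD.
have MZ (a : R) x : N (f (a *: x)) = `|a| * N (f x) by rewrite linearZ vnormZ.
have M0 x : N (f x) = 0 -> x = 0.
  by move=> /vnorm0_eq0 fx0; apply: (can_inj fK); rewrite fx0 linear0.
pose M := VNorm MD MZ M0; exists M => x A; split.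
  move=> nA; have /gN/nbhs_ballP[e /= e0 eA] : nbhs (f x) (g @^-1` A).
    by apply: gc; rewrite fK.
  apply/(@nbhs_ballP R (normed_by M)); exists e => //= y xy.
  rewrite -[y]fK; apply: eA; rewrite -ball_normE /=.
  by move: xy; rewrite -ball_normE /= => xy; rewrite -linearB.
move=> /(@nbhs_ballP R (normed_by M))[e /= e0 eA].
pose B : set V := [set v | N (f x - v) < e].
have nB : nbhs (f x) B by apply/gN; exact: (nbhsx_ballx (f x : normed_by N) e e0).
have BA : f @^-1` B `<=` A.
  move=> y xy; apply: eA; suff : M (x - y) < e by [].
  by rewrite /M /= linearB.
exact: (@filterS _ _ (nbhs_filter x) _ _ BA (fc x B nB)).
Qed.

(** The identity identifies a normable space with any norm generating its
    topology, so membership in a class does not depend on that norm, and it can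
    be carried between subspaces of C(R) and of C(Delta). *)
Lemma class_SF_isomorphic (P : completeNormedModType R -> Prop) (Y : SF R) (X : SB R) :
  banach_class P -> isomorphic (csub Y) (csub X) -> class_SF P Y <-> class_SB P X.
Proof.
move=> [_ Piso] YX; have gX := sub_norm_generates X.
have bX := normed_by_isomorphic gX; split.
  move=> [N [gN]]; apply: Piso.
  apply: isomorphic_trans (normed_by_isomorphic gN) _.
  by apply: isomorphic_trans YX _; exact: isomorphic_sym.
have [N gN] := transport_norm gX YX; move=> PX; exists N, gN.
apply: Piso PX; apply: isomorphic_trans bX _.
apply: isomorphic_trans (isomorphic_sym YX) _.
exact/isomorphic_sym/normed_by_isomorphic.
Qed.
End Isomorphism.

(** * The compact-open topology of C(R) *)

Section LineTopology.
Context {R : realType}.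
Implicit Types (f g : C_line R) (K : set R).

Lemma C_line_nbhs f K (e : R) : compact K -> 0 < e ->
  nbhs f [set g : C_line R | forall x, K x -> `|f x - g x| < e].
Proof.
move=> cK e0; pose incl g : {family compact, R -> R} := g.
have /fam_cvgP/(_ K cK) h : {family compact, incl @ nbhs f --> incl f}.
  exact: (@initial_continuous _ _ incl).
have : nbhs (incl f : {uniform` K -> R})
    [set h | forall y, K y -> `|incl f y - h y| < e].
  rewrite uniform_nbhs; exists [set xy : R * R | `|xy.1 - xy.2| < e].
  by split=> //; rewrite -entourage_ballE; exists e.
by move=> /h.
Qed.

Lemma C_line_sub_continuous :
  continuous (fun z : C_line R * C_line R => z.1 - z.2).
Proof.
move=> [f g]; apply: C_line_cvg => K e cK e0.
have e2 : 0 < e / 2 by rewrite divr_gt0.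
exists ([set f' : C_line R | forall x, K x -> `|f x - f' x| < e / 2],
        [set g' : C_line R | forall x, K x -> `|g x - g' x| < e / 2]).
  by split; apply: C_line_nbhs.
move=> [f' g'] /= [ff gg] x Kx.
have {}ff := ff x Kx; have {}gg := gg x Kx.
suff : `|(f x - g x) - (f' x - g' x)| <= e by [].
by rewrite ler_norml; move: ff gg; rewrite !ltr_norml; lra.
Qed.

HB.instance Definition _ :=
  PreTopologicalNmodule_isTopologicalZmodule.Build (C_line R)
    C_line_sub_continuous.

Lemma C_line_bounded f K : compact K ->
  exists2 M : R, 0 < M & forall x, K x -> `|f x| <= M.
Proof.
move=> cK; have : compact (f @` K).
  by apply: continuous_compact => //; apply: continuous_subspaceT; exact: cts_fun.
move=> /compact_bounded[M [_ MP]]; exists (`|M| + 1) => [|x Kx].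
  by rewrite ltr_pwDr.
apply: MP; last by exists x.
by rewrite (le_lt_trans (ler_norm M))// ltrDl.
Qed.

Lemma C_line_scale_continuous :
  continuous (fun z : R^o * C_line R => z.1 *: z.2).
Proof.
move=> [a f]; apply: C_line_cvg => K e cK e0.
have [M M0 fM] := C_line_bounded f cK.
pose d := e / (`|a| + M + e + 1).
have D0 : 0 < `|a| + M + e + 1 by have := normr_ge0 a; lra.
have d0 : 0 < d by rewrite divr_gt0.
exists (ball (a : R^o) d, [set g : C_line R | forall x, K x -> `|f x - g x| < d]).
  by split; [exact: nbhsx_ballx|exact: C_line_nbhs].
move=> [b g] /= [ab fg] x Kx; have {fg} := fg x Kx; have {}fM := fM x Kx.
move: ab; rewrite -ball_normE /= => ab fg.
suff : `|a * f x - b * g x| <= e by [].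
have -> : a * f x - b * g x = (a - b) * f x + a * (f x - g x)
    - (a - b) * (f x - g x) by ring.
have d1 : d < 1 by rewrite /d ltr_pdivrMr// mul1r; have := normr_ge0 a; lra.
have dE : d * (`|a| + M + e + 1) = e by rewrite /d divfK// gt_eqF.
apply: le_trans (ler_normB _ _) _; rewrite (le_trans (lerD (ler_normD _ _) (lexx _)))//.
rewrite !normrM.
have : `|a - b| * `|f x| <= d * M by rewrite ler_pM// ltW.
have : `|a| * `|f x - g x| <= `|a| * d by rewrite ler_wpM2l// ltW.
have : `|a - b| * `|f x - g x| <= d * 1 by rewrite ler_pM// ltW// (lt_trans fg).
have : 0 < d * e by rewrite mulr_gt0.
lra.
Qed.

HB.instance Definition _ :=
  TopologicalZmodule_isTopologicalLmodule.Build R (C_line R)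
    C_line_scale_continuous.

Lemma C_line_eval_continuous (x : R) : continuous (fun f : C_line R => f x).
Proof.
move=> f A /nbhs_ballP[e /= e0 eA].
move: (C_line_nbhs f (@compact_set1 _ x) e0).
by apply: (@filterS _ _ (nbhs_filter f)) => g /(_ x erefl) fg; exact: eA.
Qed.

(** Evaluation at a point where two functions differ separates them. *)
Lemma C_line_hausdorff : hausdorff_space (C_line R).
Proof.
move=> f g fg; apply/continuousEP => x.
apply: (@Rhausdorff R) => U V Uf Vg.
have [h [Uh Vh]] := fg _ _ (C_line_eval_continuous Uf) (C_line_eval_continuous Vg).
by exists (h x).
Qed.

End LineTopology.

(** * Images of closed subspaces *)

Section ClosedSubspace.
Context {R : realType}.

Lemma effros_measurable (G : preTopologicalLmodType R) (U : set G) : open U ->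
  measurable [set X : closed_subspace G | X `&` U !=set0].
Proof. by move=> oU; apply: sub_sigma_algebra; exists U. Qed.

Lemma closed_subspace_inj (E : preTopologicalLmodType R) (X Y : closed_subspace E) :
  X = Y :> set E -> X = Y.
Proof.
case: X Y => [X cX sX] [Y cY sY] /= XY; rewrite XY in cX sX *.
by congr ClosedSubspace; exact: Prop_irrelevance.
Qed.

End ClosedSubspace.

Section Pushforward.
Context {R : realType} {E F : topologicalLmodType R}.
Implicit Type X : closed_subspace E.

Lemma closure_submod_closed (S : set F) :
  submod_closed [in S] -> submod_closed [in closure S].
Proof.
move=> [S0 SD]; split=> [|a x y]; first by apply/mem_set/subset_closure/set_mem.
rewrite !inE => clx cly A nA.
have sa : (fun z => a *: z) @ nbhs x --> a *: x.
  have ax : (fun z : F => ((a : R^o), z)) @ nbhs x --> ((a : R^o), x).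
    by apply: (@cvg_pair _ _ _ _ (nbhs (a : R^o))); [exact: cvg_cst|exact: cvg_id].
  by have := cvg_comp _ _ ax (@scale_continuous R F (a, x)).
have sc : (fun z : F * F => (a *: z.1, z.2)) @ nbhs (x, y) --> (a *: x, y).
  apply: (@cvg_pair _ _ _ _ (nbhs (a *: x)) (nbhs y)); last exact: cvg_snd.
  by have := cvg_comp _ _ cvg_fst sa; exact.
have := cvg_comp _ _ sc (@add_continuous F (a *: x, y)) A nA.
move=> [[B C] /= [nB nC] BC].
have [x' [Sx Bx]] := clx _ nB; have [y' [Sy Cy]] := cly _ nC.
exists (a *: x' + y'); split; last exact: (BC (x', y')).
by apply: set_mem; apply: SD; apply: mem_set.
Qed.

Variable L : {linear E -> F}.
Hypothesis Lc : continuous L.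

Lemma image_submod_closed X : submod_closed [in L @` X].
Proof.
have [X0 XD] := csub_submod X; split=> [|a u v]; rewrite !inE.
  by exists 0; [exact: set_mem|rewrite linear0].
move=> [x Xx <-] [y Xy <-]; exists (a *: x + y).
  by apply: set_mem; apply: XD; apply: mem_set.
by rewrite linearP.
Qed.

Definition push X : closed_subspace F :=
  ClosedSubspace (@closed_closure _ (L @` X))
    (closure_submod_closed (image_submod_closed X)).

(** An open set that meets a closure already meets the set. *)
Lemma push_meets X (U : set F) : open U ->
  (push X `&` U !=set0) = (X `&` L @^-1` U !=set0).
Proof.
move=> oU; apply/propext; split.
  move=> [y [/= cy Uy]].
  have [_ [[x Xx <-] ULx]] := cy U (open_nbhs_nbhs (conj oU Uy)).
  by exists x.
by move=> [x [Xx ULx]]; exists (L x); split=> //; apply: subset_closure; exists x.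
Qed.

Lemma measurable_push : measurable_fun [set: closed_subspace E] push.
Proof.
apply: (measurability (@effros_gen R F)) => //.
move=> _ [_ [U oU <-] <-]; rewrite setTI.
have -> : push @^-1` [set Y | Y `&` U !=set0] = [set X | X `&` L @^-1` U !=set0].
  by apply/funext => X; rewrite /= push_meets.
by apply: effros_measurable; apply: open_comp => // x _; exact: Lc.
Qed.

(** For normed spaces this is the estimate [`|x| <= c * `|L x|] on [X].  Stated
    with filters it makes sense for the topology of C(R), which comes from no
    single norm, and can be fed both Cauchy filters of differences and
    neighbourhood filters. *)
Definition bounded_below (X : set E) := forall G : set_system E,
  ProperFilter G -> G X -> L @ G --> (0 : F) -> G --> (0 : E).

(** If [L x] tends to [y] with [x] in [X], then [L] of the differences tends to
    0, so boundedness below makes [x] range over a Cauchy filter; its limit lies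
    in the closed set [X] and is a preimage of [y]. *)
Lemma push_image X : tvs_complete E -> hausdorff_space F ->
  bounded_below X -> push X = L @` X :> set F.
Proof.
move=> cE hF bX; apply/seteqP; split; last exact: subset_closure.
(* the sets of points of X that L sends near y *)
move=> y cy; pose G := filter_from (nbhs y) (fun U => X `&` L @^-1` U).
have GP : ProperFilter G.
  apply: filter_from_proper.
    apply: filter_from_filter; first by exists setT; exact: filterT.
    move=> U V nU nV; exists (U `&` V); first exact: filterI.
    by move=> x [Xx [Ux Vx]]; split; split.
  by move=> U /cy[_ [[x Xx <-] Ux]]; exists x.
have GX : G X by exists setT; [exact: filterT|move=> x []].
have LG : L @ G --> y by move=> U nU; exists U => // x [].
have [U nU|x Gx] := cE G GP.
  have dP : ProperFilter ((fun p : E * E => p.1 - p.2) @ (G, G)).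
    exact: fmap_proper_filter.
  suff : (fun p : E * E => p.1 - p.2) @ (G, G) --> (0 : E) by apply.
  apply: bX.
    exists (X : set E, X : set E) => // -[a b] [/= Xa Xb].
    apply: set_mem; apply: (rpredB (S := csub_pred X)); exact: mem_set.
  move=> V V0.
  have : nbhs (y, y) ((fun p : F * F => p.1 - p.2) @^-1` V).
    by apply: (@sub_continuous F (y, y)); rewrite /= subrr.
  move=> [[A B] /= [nA nB] AB]; exists (L @^-1` A, L @^-1` B).
    by split; apply: LG.
  by move=> [a b] [/= Aa Bb]; rewrite linearB; exact: (AB (L a, L b)).
exists x; first by apply: (closed_cvg _ (@csub_closed _ _ X) GX) Gx.
apply: (cvg_unique hF (F := L @ G)) => //.
by move=> U nU; apply: Gx; exact: Lc.
Qed.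

(** Boundedness below applied to a constant filter gives injectivity, and
    applied to differences of preimages gives continuity of the inverse. *)
Lemma push_isomorphic X : tvs_complete E -> hausdorff_space E ->
  hausdorff_space F -> bounded_below X -> isomorphic (csub X) (csub (push X)).
Proof.
move=> cE hE hF bX; have pE := push_image cE hF bX.
have valX (x : csub X) : csub_set X (val x) by apply: set_mem; exact: (valP x).
have valY (y : csub (push X)) : (L @` X) (val y).
  by rewrite -pE; apply: set_mem; exact: (valP y).
have Linj x : csub_set X x -> L x = 0 -> x = 0.
  move=> Xx Lx0; have FF : ProperFilter (globally [set x]).
    exact: (@globally_properfilter _ _ x).
  apply: (cvg_unique hE (F := globally [set x])).
    by move=> A nA _ ->; exact: nbhs_singleton.
  apply: bX; first by move=> _ ->.
  by move=> A nA _ -> /=; rewrite Lx0; exact: nbhs_singleton.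
have fP (x : csub X) : L (val x) \in csub_pred (push X).
  by apply/mem_set; rewrite pE; exists (val x).
pose f (x : csub X) : csub (push X) := Sub (L (val x)) (fP x).
have fl : linear f by move=> a x y; apply: val_inj; rewrite /= !linearP.
pose fL := GRing.isLinear.Build R (csub X) (csub (push X)) *:%R f fl.
pose f' : {linear csub X -> csub (push X)} := HB.pack f fL.
have /choice[g gP] : forall y : csub (push X), exists x : csub X, f x = y.
  move=> y; have [x Xx xy] := valY y.
  by exists (Sub x (mem_set Xx)); apply: val_inj.
have fi : injective f.
  move=> x y fxy; apply/eqP; rewrite -subr_eq0; apply/eqP; apply: val_inj => /=.
  apply: Linj; first exact: (valX (x - y)).
  rewrite raddfB/=; apply/eqP; rewrite subr_eq0; apply/eqP.
  exact: (congr1 val fxy).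
exists f', g; split.
- by move=> x; apply: fi; rewrite gP.
- exact: gP.
- apply: continuous_comp_initial => x.
  apply: (@continuous_comp _ _ _ (val : csub X -> E) L); last exact: Lc.
  exact: initial_continuous.
- apply: continuous_comp_initial => y.
  have valc : continuous (val : csub (push X) -> F) by exact: initial_continuous.
  have shift (H : topologicalLmodType R) (a b : H) :
      (fun z => z + b) @ nbhs a --> a + b.
    apply: (@continuous_comp _ _ _ (fun z : H => (z, b))
      (fun z : H * H => z.1 + z.2)); last exact: add_continuous.
    by apply: (@cvg_pair _ _ _ _ _ (nbhs b)); [exact: cvg_id|exact: cvg_cst].
  (* L (d z) is z - y, which tends to 0 *)
  pose d z := val (g z) - val (g y).
  have d0 : d @ nbhs y --> (0 : E).
    apply: bX.
      apply: (@filterE _ _ (nbhs_filter y)) => z.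
      exact: (valX (g z - g y)).
    have Ld z : L (d z) = val z - val y.
      by rewrite /d linearB -[in RHS](gP z) -[in RHS](gP y).
    have h := @shift F (val y) (- val y); rewrite subrr in h.
    move=> V V0; have := cvg_comp _ _ (valc y) h V V0.
    by apply: (@filterS _ _ (nbhs_filter y)) => z /=; rewrite Ld.
  have h := @shift E 0 (val (g y)); rewrite add0r in h.
  move=> V V0; have := cvg_comp _ _ d0 h V V0.
  by apply: (@filterS _ _ (nbhs_filter y)) => z /=; rewrite /d subrK.
Qed.

End Pushforward.

(** * Extending functions from the Cantor set to the line *)

Section CantorExtension.
Context {R : realType}.

Definition agree n (a b : cantor_space) := forall i, (i < n)%N -> a i = b i.

Lemma cylinder_nbhs (a : cantor_space) n : nbhs a (agree n a).
Proof.
elim: n => [|n IH]; first by apply: filterE => b i; rewrite ltn0.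
have pn : nbhs a (proj n @^-1` [set a n]).
  apply: open_nbhs_nbhs; split=> //.
  apply: open_comp; last exact: discrete_open.
  by move=> + _; exact: proj_continuous.
apply: filterS2 IH pn => b ab /= bn i; rewrite ltnS leq_eqVlt.
by case/predU1P => [->|/ab//]; rewrite -bn.
Qed.

(** Otherwise some sequence outside [U] would agree with [a] on longer and longer
    prefixes, hence converge to [a] coordinatewise. *)
Lemma nbhs_cylinder (a : cantor_space) (U : set cantor_space) :
  nbhs a U -> exists n, agree n a `<=` U.
Proof.
move=> aU; apply: contrapT => /forallNP nU.
have /choice[s sP] : forall n, exists b, agree n a b /\ ~ U b.
  move=> n; apply: contrapT => /forallNP h; apply: (nU n) => b ab.
  by apply: contrapT => Ub; apply: (h b).
have : {ptws, (s @ \oo) --> a}.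
  apply/pointwise_cvgP => i A /nbhs_singleton Aa; exists i.+1 => // n /= ni.
  by have [/(_ i ni) <-] := sP n.
by move=> /(_ _ aU)[n _ /(_ n (leqnn n))]; have [] := sP n.
Qed.

(** Uniform continuity, through near-covering compactness: around each point one
    cylinder serves all its members and all longer prefixes. *)
Lemma cantor_uniform (f : cantor_space -> R) (e : R) : continuous f -> 0 < e ->
  exists n, forall a b, agree n a b -> `|f a - f b| <= e.
Proof.
move=> fc e0; have e2 : 0 < e / 2 by rewrite divr_gt0.
pose P n a := forall b, agree n a b -> `|f a - f b| <= e.
have /compact_near_coveringP/(_ nat \oo P) := cantor_space_compact.
case=> [|N _ NP]; last by exists N => a; exact: (NP N (leqnn N) a).
move=> a _; have /nbhs_cylinder[N NP] := fc a _ (nbhsx_ballx (f a) _ e2).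
exists (agree N a, [set n | (N <= n)%N]).
  by split; [exact: cylinder_nbhs|exists N].
move=> [b n] /= [ab Nn] c bc.
have := NP b ab; have : ball (f a) (e / 2) (f c).
  by apply: NP => i iN; rewrite ab// bc// (leq_trans iN).
by rewrite /= -ball_normE /= !ltr_norml ler_norml; lra.
Qed.

Definition scons (b : bool) (a : cantor_space) : cantor_space :=
  fun i => if i is j.+1 then a j else b.

(** A closed formula for the continuous function equal to 0 on the left of 1/3, to
    1 on the right of 2/3 and affine in between; the absolute values give
    continuity at once. *)
Definition weight (x : R) : R := (`|3 * x - 1| - `|3 * x - 2| + 1) / 2.

Lemma weight_itv x : 0 <= weight x <= 1.
Proof.
rewrite /weight; case: (ger0P (3 * x - 1)) => ?; case: (ger0P (3 * x - 2)) => ?;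
  apply/andP; split; lra.
Qed.

Lemma weight_low x : 3 * x <= 1 -> weight x = 0.
Proof. by move=> h; rewrite /weight !ler0_norm; lra. Qed.

Lemma weight_high x : 2 <= 3 * x -> weight x = 1.
Proof. by move=> h; rewrite /weight !ger0_norm; lra. Qed.

Lemma affine_continuous (c d : R) : continuous (fun x : R => c * x - d).
Proof.
by move=> x; apply: cvgB; [apply: cvgM; [exact: cvg_cst|exact: cvg_id]|exact: cvg_cst].
Qed.

Lemma weight_continuous : continuous weight.
Proof.
move=> x; apply: cvgM; last exact: cvg_cst.
apply: cvgD; last exact: cvg_cst.
by apply: cvgB; apply: cvg_norm; exact: affine_continuous.
Qed.

(** Self-similar form of the piecewise linear extension from the middle-thirds
    Cantor set, cut at depth [n]: the two halves of [f] are extended on the left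
    and right thirds, which [3 * x] and [3 * x - 2] blow up to [0, 1], and the
    weight interpolates on the middle third.  Linearity, positivity and
    continuity all go through by induction on [n]. *)
Fixpoint ext_approx n (f : cantor_space -> R) (x : R) : R :=
  if n is m.+1 then
    (1 - weight x) * ext_approx m (f \o scons false) (3 * x - 0) +
    weight x * ext_approx m (f \o scons true) (3 * x - 2)
  else f (fun=> false).

Lemma ext_approx_continuous n f : continuous (ext_approx n f).
Proof.
elim: n f => [|n IH] f x /=; first exact: cvg_cst.
have comp g (d : R) : {for x, continuous (fun y : R => ext_approx n g (3 * y - d))}.
  by apply: continuous_comp; [exact: affine_continuous|exact: IH].
apply: cvgD; apply: cvgM; last 3 first.
- exact: comp.
- exact: weight_continuous.
- exact: comp.
by apply: cvgB; [exact: cvg_cst|exact: weight_continuous].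
Qed.

Lemma ext_approx_linear n (c : R) f g x :
  ext_approx n (fun a => c * f a + g a) x = c * ext_approx n f x + ext_approx n g x.
Proof. by elim: n f g x => //= n IH f g x; rewrite !IH; ring. Qed.

(** Every value of the extension is an average of values of [f]. *)
Lemma ext_approx_itv n (l u : R) f x :
  (forall a, l <= f a <= u) -> l <= ext_approx n f x <= u.
Proof.
elim: n f x => //= n IH f x lfu.
have /andP[w0 w1] := weight_itv x.
have /andP[p0 p1] := IH (f \o scons false) (3 * x - 0) (fun a => lfu _).
have /andP[q0 q1] := IH (f \o scons true) (3 * x - 2) (fun a => lfu _).
by apply/andP; split; nra.
Qed.

(** Cutting at depth [n] amounts to replacing [f] by its value at one point of
    each cylinder of depth [n]; this costs at most the oscillation of [f] on
    these cylinders. *)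
Lemma ext_approx_osc n m (e : R) f x : (forall a b, agree n a b -> `|f a - f b| <= e) ->
  (n <= m)%N -> `|ext_approx n f x - ext_approx m f x| <= e.
Proof.
elim: n m f x => [|n IH] m f x fe.
  move=> _; have := @ext_approx_itv m (f (fun=> false) - e) (f (fun=> false) + e) f x.
  rewrite /= ler_norml => h; suff /h : forall a,
    f (fun=> false) - e <= f a <= f (fun=> false) + e by lra.
  by move=> a; have := fe (fun=> false) a; rewrite ler_norml => /(_ _)/andP[//|]; lra.
case: m => // m; rewrite ltnS => nm /=.
have sfe b a a' : agree n a a' -> `|(f \o scons b) a - (f \o scons b) a'| <= e.
  by move=> aa; apply: fe => -[|i]//=; exact: aa.
have := IH m _ (3 * x - 0) (sfe false) nm; have := IH m _ (3 * x - 2) (sfe true) nm.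
have := weight_itv x; move: (ext_approx _ _ _) (ext_approx _ _ _) (ext_approx _ _ _) (ext_approx _ _ _).
move=> p q r s; move: (weight x) => w /andP[w0 w1]; rewrite !ler_norml.
by move=> /andP[? ?] /andP[? ?]; apply/andP; split; nra.
Qed.

(** At the point of the Cantor set coded by the first [n] digits of [a], the
    extension reads off a value of [f].  The recursion follows the coding: digit
    0 leads to the left third, digit 1 to the right third, where the weight is 0
    or 1. *)
Lemma ext_approx_attained n (a : cantor_space) : exists x b,
  [/\ 0 <= x <= 1, agree n a b & forall f, ext_approx n f x = f b].
Proof.
elim: n a => [|n IH] a.
  by exists 0, (fun=> false); split; rewrite ?lexx ?ler01// => i; rewrite ltn0.
have [x [b [/andP[x0 x1] ab fb]]] := IH (fun i => a i.+1).
exists (((a 0)%:R * 2 + x) / 3), (scons (a 0) b); split.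
- by case: (a 0) => /=; lra.
- by move=> [|i]//= /ab.
- move=> f /=; case: (a 0) => /=.
  + rewrite weight_high; last by rewrite mul1r; lra.
    have -> (p q : R) : (1 - 1) * p + 1 * q = q by ring.
    rewrite -[RHS]/((f \o scons true) b) -fb.
    by congr ext_approx; lra.
  + rewrite weight_low; last by rewrite mul0r; lra.
    have -> (p q : R) : (1 - 0) * p + 0 * q = p by ring.
    rewrite -[RHS]/((f \o scons false) b) -fb.
    by congr ext_approx; lra.
Qed.
End CantorExtension.

Section ExtensionOperator.
Context {R : realType}.
Implicit Type f : C_cantor R.

Definition ext_lim f (x : R) : R := limn (fun n => ext_approx n f x).

Lemma ext_lim_near f (e : R) : 0 < e ->
  \forall n \near \oo, forall x, `|ext_lim f x - ext_approx n f x| <= e.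
Proof.
have [| |l lP] := @unif_cauchy R nat R (fun n => ext_approx n f) \oo [set setT] _.
- by move=> x; exists setT.
- move=> _ d -> d0; have d3 : 0 < d / 3 by rewrite divr_gt0.
  have [N NP] := cantor_uniform (@cts_fun _ _ f) d3.
  exists ([set n | (N <= n)%N], [set n | (N <= n)%N]); first by split; exists N.
  move=> [n m] /= [Nn Nm] x _.
  have := ext_approx_osc x NP Nn; have := ext_approx_osc x NP Nm.
  by rewrite ltr_norml !ler_norml; lra.
have {}lP d : 0 < d -> \forall n \near \oo, forall x, `|l x - ext_approx n f x| <= d.
  by move=> d0; apply: filterS (lP setT d erefl d0) => n h x; exact: h.
suff -> : ext_lim f = l by exact: lP.
apply/funext => x; apply/cvg_lim => //; apply/cvgrPdist_le => d /lP.
by apply: filterS => n; exact.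
Qed.

Lemma ext_lim_cvg f x : ext_approx n f x @[n --> \oo] --> ext_lim f x.
Proof.
apply/cvgrPdist_le => d /(ext_lim_near f).
by apply: filterS => n; exact.
Qed.

Lemma ext_lim_continuous f : continuous (ext_lim f).
Proof.
move=> x; apply/cvgrPdist_le => e e0; have e3 : 0 < e / 3 by rewrite divr_gt0.
near \oo => n.
have fn : forall y, `|ext_lim f y - ext_approx n f y| <= e / 3.
  by near: n; exact: ext_lim_near.
near=> y.
have : `|ext_approx n f x - ext_approx n f y| <= e / 3.
  by near: y; have /cvgrPdist_le := @ext_approx_continuous R n f x; exact.
by have := fn x; have := fn y; rewrite !ler_norml; lra.
Unshelve. all: by end_near. Qed.

Definition extend f : C_line R := mkcts (@ext_lim_continuous f).

Lemma extendE f x : extend f x = ext_lim f x. Proof. by []. Qed.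

Lemma extend_linear : linear extend.
Proof.
move=> a f g; apply/continuousEP => x.
have h : ext_approx n (a *: f + g) x @[n --> \oo] --> a * ext_lim f x + ext_lim g x.
  rewrite (_ : (fun n => _) = (fun n => a * ext_approx n f x + ext_approx n g x)).
    apply: cvgD; last exact: ext_lim_cvg.
    by apply: cvgM; [exact: cvg_cst|exact: ext_lim_cvg].
  by apply/funext => n; rewrite -ext_approx_linear.
exact: (cvg_lim _ h).
Qed.

HB.instance Definition _ :=
  GRing.isLinear.Build R (C_cantor R) (C_line R) *:%R extend extend_linear.

Lemma extend_le f x : `|extend f x| <= `|f|.
Proof.
apply/ler_addgt0Pr => e e0.
have [N _ /(_ N (leqnn N))/(_ x)] := ext_lim_near f e0.
have := @ext_approx_itv R N (- `|f|) `|f| f x; rewrite ler_norml => h.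
have /h : forall a, - `|f| <= f a <= `|f|.
  by move=> a; rewrite -ler_norml; exact: (sup_norm_ub f).
by move=> /andP[? ?] /andP[? ?]; rewrite extendE ler_norml; apply/andP; split; lra.
Qed.

(** Points of [0, 1] that code long prefixes of [a] carry values close to [f a];
    with [extend_le] this makes [extend] an isometry for the supremum over
    [0, 1]. *)
Lemma extend_ge f (c : R) : (forall x, 0 <= x <= 1 -> `|extend f x| <= c) -> `|f| <= c.
Proof.
move=> fc; apply: (@sup_norm_le R f) => a; apply/ler_addgt0Pr => e e0.
have e2 : 0 < e / 2 by rewrite divr_gt0.
have [N NP] := cantor_uniform (@cts_fun _ _ f) e2.
have [M _ MP] := ext_lim_near f e2.
(* depth N controls the oscillation of f, depth M the distance to the limit *)
have [x [b [/fc fx ab fb]]] := @ext_approx_attained R (maxn N M) a.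
have := MP (maxn N M) (leq_maxr _ _) x; rewrite fb.
have : `|f a - f b| <= e / 2.
  by apply: NP => i iN; apply: ab; rewrite (leq_trans iN)// leq_maxl.
by move: fx; rewrite extendE !ler_norml; lra.
Qed.

Lemma extend_continuous : continuous extend.
Proof.
move=> f; have FF := nbhs_filter f.
apply: C_line_cvg => K e cK e0.
apply: (@filterS _ _ (nbhs_filter f) _ _ _ (nbhsx_ballx f e e0)) => g.
rewrite -ball_normE /= => fg x _.
rewrite (_ : extend f x - _ = extend (f - g) x); last by rewrite linearB.
by apply: le_trans (extend_le _ _) _; exact: ltW.
Qed.

Lemma extend_bounded_below (X : set (C_cantor R)) : bounded_below extend X.
Proof.
move=> G GP _ TG; apply/cvgrPdist_le => e e0.
have := TG _ (C_line_nbhs 0 (@segment_compact R 0 1) e0).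
apply: (@filterS _ G) => g gK; rewrite sub0r normrN; apply: extend_ge => x x01.
have /ltW : `|(0 : R) - extend g x| < e by apply: gK; rewrite /= in_itv.
by rewrite sub0r normrN.
Qed.

Lemma extend_inj : injective extend.
Proof.
move=> f g fg; apply/eqP; rewrite -subr_eq0 -normr_le0; apply: extend_ge => x _.
have -> : extend (f - g) = 0 by rewrite linearB /= fg subrr.
by rewrite normr0.
Qed.
End ExtensionOperator.

Section FromBanach.
Context {R : realType}.

Definition to_SF : SB R -> SF R := push extend.

Lemma measurable_to_SF : measurable_fun [set: SB R] to_SF.
Proof. by apply: measurable_push; exact: extend_continuous. Qed.

Lemma to_SFE (X : SB R) : to_SF X = extend @` X :> set (C_line R).
Proof.
apply: push_image.
- exact: extend_continuous.
- exact: C_cantor_complete.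
- exact: C_line_hausdorff.
- exact: extend_bounded_below.
Qed.

Lemma to_SF_inj : injective to_SF.
Proof.
move=> X Y XY; apply: closed_subspace_inj; apply/funext => f.
by rewrite -!(image_inj (f := extend) extend_inj) -!to_SFE XY.
Qed.

Lemma to_SF_isomorphic (X : SB R) : isomorphic (csub (to_SF X)) (csub X).
Proof.
apply: isomorphic_sym; apply: push_isomorphic.
- exact: extend_continuous.
- exact: C_cantor_complete.
- exact: norm_hausdorff.
- exact: C_line_hausdorff.
- exact: extend_bounded_below.
Qed.

End FromBanach.

(** * Restricting functions to segments *)

Section RestrictionOperators.
Context {R : realType}.

(** A filter on the subtype is pushed to the ambient space, where it clusters in
    [K]; the cluster point lifts back. *)
Lemma set_type_compact (K : set R) : compact K -> compact [set: set_type K].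
Proof.
move=> cK F FF _; have vP : ProperFilter (val @ F) by exact: fmap_proper_filter.
have [|x [Kx clx]] := cK (val @ F) vP.
  by apply: (@filterE _ F) => z; exact: set_valP.
exists (exist _ x (mem_set Kx)); split=> // A B FA [C [/= [W oW <-] /= Wx] CB].
have [_ [[z Az <-] Wz]] : val @` A `&` W !=set0.
  apply: clx; last exact: open_nbhs_nbhs.
  by apply: (@filterS _ F _ _ _ _ FA) => z Az; exists z.
by exists z; split=> //; exact: CB.
Qed.

Lemma set_type_hausdorff (K : set R) : hausdorff_space (set_type K).
Proof.
move=> x y xy; apply: val_inj; apply: (@Rhausdorff R) => A B xA yB.
have vc : continuous (val : set_type K -> R) by exact: initial_continuous.
by have [z [Az Bz]] := xy _ _ (vc _ _ xA) (vc _ _ yB); exists (val z).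
Qed.

(** Every nonempty compact metric space is a continuous image of the Cantor
    space, here applied to the segment [-k, k] as a space of its own. *)
Lemma cantor_onto_segment (k : nat) : exists s : cantor_space -> R,
  continuous s /\ forall x, (exists a, s a = x) <-> `|x| <= k%:R.
Proof.
pose K := `[- k%:R : R, k%:R]%classic.
have K0 : (0 : R) \in K by apply/mem_set; rewrite /K /= in_itv /= oppr_le0 ler0n.
pose T0 : pseudoMetricType R := set_type K.
pose pT := isPointed.Build T0 (exist _ 0 K0 : set_type K).
pose T : pseudoPMetricType R := HB.pack T0 pT.
have [|s sc] := @cantor_surj R T (set_type_compact (@segment_compact R _ _)).
  exact: set_type_hausdorff.
exists (val \o s : cantor_space -> R); split.
  move=> a; apply: continuous_comp; first exact: sc.
  exact: (@initial_continuous _ _ (val : set_type K -> R)).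
move=> x; rewrite ler_norml; split=> [[a <-]|xk].
  have /set_mem : val (s a) \in K by exact: (valP (s a)).
  by rewrite /K /= in_itv.
have Kx : x \in K by apply/mem_set; rewrite /K /= in_itv.
have [a _ sa] := @surj _ _ _ _ s (exist _ x Kx : T) I.
by exists a; rewrite /= sa.
Qed.

Definition cover_segment k : cantor_space -> R :=
  projT1 (cid (@cantor_onto_segment k)).

Lemma cover_segment_continuous k : continuous (cover_segment k).
Proof. by rewrite /cover_segment; case: cid => s /= []. Qed.

Lemma cover_segmentP k x : (exists a, cover_segment k a = x) <-> `|x| <= k%:R.
Proof. by rewrite /cover_segment; case: cid => s /= [_ ]. Qed.

Lemma restr_subproof k (f : C_line R) : continuous (f \o cover_segment k).
Proof.
move=> a; apply: continuous_comp; first exact: cover_segment_continuous.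
exact: cts_fun.
Qed.

(** Restriction to [-k, k], read through a parametrization of the segment by the
    Cantor space so as to land in C(Delta). *)
Definition restr k (f : C_line R) : C_cantor R := mkcts (@restr_subproof k f).

Lemma restr_linear k : linear (restr k).
Proof. by move=> a f g; apply/continuousEP. Qed.

HB.instance Definition _ k := GRing.isLinear.Build R (C_line R) (C_cantor R) *:%R
  (restr k) (restr_linear k).

(** Surjectivity of the parametrization: the norm of [restr k f] is the supremum
    of [`|f|] over [-k, k]. *)
Lemma restr_leP k f (c : R) :
  `|restr k f| <= c <-> forall x, `|x| <= k%:R -> `|f x| <= c.
Proof.
split=> [fc x /cover_segmentP[a <-]|fc].
  by apply: le_trans fc; exact: (sup_norm_ub (restr k f)).
by apply: (@sup_norm_le R (restr k f)) => a; apply: fc; apply/cover_segmentP; exists a.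
Qed.

Lemma restr_continuous k : continuous (restr k).
Proof.
move=> f; have FF : Filter (nbhs f) := nbhs_filter f.
apply/cvgrPdist_le => e e0.
have := C_line_nbhs f (@segment_compact R (- k%:R) k%:R) e0.
apply: (@filterS _ _ (nbhs_filter f)) => g fg.
rewrite -linearB; apply/restr_leP => x; rewrite ler_norml => xk.
by apply: ltW; apply: fg; rewrite /= in_itv.
Qed.

(** The seminorms [`|restr k f|] define the topology, a compact set being
    contained in some [-k, k]. *)
Lemma C_line_cvg0 (G : set_system (C_line R)) : Filter G ->
  (forall k, restr k @ G --> (0 : C_cantor R)) -> G --> (0 : C_line R).
Proof.
move=> FG Gk; apply: C_line_cvg => K e /compact_bounded[M [_ MP]] e0.
have [k Mk] : exists k : nat, M < k%:R.
  by exists (Num.truncn `|M|).+1; rewrite (le_lt_trans (ler_norm M))// truncnS_gt.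
have /cvgrPdist_le/(_ e e0) := Gk k.
apply: filterS => g; rewrite sub0r normrN => /restr_leP gk x Kx.
by rewrite sub0r normrN; apply: gk; exact: (MP k%:R).
Qed.
End RestrictionOperators.

(** * Normable subspaces of C(R) *)

Section Normable.
Context {R : realType}.
Implicit Type X : SF R.

(** The subspaces whose topology is generated by the supremum over [-k, k]; the
    constants are natural numbers so that only countably many occur. *)
Definition segment_normed (k : nat) : set (SF R) := [set X |
  forall m, exists c : nat, forall f, csub_set X f ->
    `|restr m f| <= c%:R * `|restr k f|].

(** For fixed [m] and [c] the estimate holds on [X] exactly when [X] misses the
    open set where it fails, so no choice of dense sequences in [X] is
    involved. *)
Lemma measurable_segment_normed k : measurable (segment_normed k).
Proof.
pose U (m c : nat) := [set f : C_line R |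
  0 < `|restr m f| - c%:R * `|restr k f|].
have -> : segment_normed k =
    \bigcap_m \bigcup_c ~` [set X : SF R | X `&` U m c !=set0].
  apply/seteqP; split=> X.
    move=> kX m _; have [c cP] := kX m; exists c => // -[f [Xf]].
    by rewrite /U /= subr_gt0 ltNge cP.
  move=> XU m; have [c _ Xc] := XU m I; exists c => f Xf.
  by rewrite leNgt; apply/negP => h; apply: Xc; exists f; rewrite /U /= subr_gt0.
apply: bigcapT_measurable => m; apply: bigcupT_measurable => c.
apply: measurableC; apply: effros_measurable.
apply: (@open_comp _ _ (fun f : C_line R => `|restr m f| - c%:R * `|restr k f|)
  [set y | 0 < y]); last exact: open_gt.
move=> f _; have FF : Filter (nbhs f) := nbhs_filter f.
apply: cvgB; first by apply: cvg_norm; exact: restr_continuous.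
apply: cvgM; first exact: cvg_cst.
by apply: cvg_norm; exact: restr_continuous.
Qed.

Lemma restr_bounded_below k X :
  segment_normed k X -> bounded_below (restr k) X.
Proof.
move=> kX G GP GX kG; apply: C_line_cvg0 => m; apply/cvgrPdist_le => e e0.
have [c cP] := kX m.
have e0' : 0 < e / c.+1%:R by rewrite divr_gt0.
have /cvgrPdist_le/(_ _ e0') := kG; apply: filterS2 GX => f Xf.
rewrite !sub0r !normrN => kf; apply: le_trans (cP f Xf) _.
apply: le_trans (ler_wpM2l _ kf) _; first exact: ler0n.
by rewrite mulrCA ler_piMr ?(ltW e0)// ler_pdivrMr// mul1r ler_nat.
Qed.

(** Scaling turns an implication between unit balls into an inequality.  Since
    [q x] may vanish, [x] is rescaled by [a / s] for [s > q x], and [s] then tends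
    to [q x]. *)
Lemma seminorm_le (V : lmodType R) (p q : V -> R) (a b : R) :
  (forall t x, p (t *: x) = `|t| * p x) -> (forall t x, q (t *: x) = `|t| * q x) ->
  (forall x, 0 <= q x) -> 0 < a ->
  (forall x, q x < a -> p x <= b) -> forall x, p x <= b / a * q x.
Proof.
move=> pZ qZ q0 a0 qp x.
have key s : q x < s -> p x <= b / a * s.
  move=> qs; have s0 : 0 < s by exact: le_lt_trans qs.
  have t0 : 0 < a / s by rewrite divr_gt0.
  have := qp ((a / s) *: x); rewrite pZ qZ (gtr0_norm t0).
  rewrite -ltr_pdivlMl// invf_div divfK ?gt_eqF// => /(_ qs).
  by rewrite -ler_pdivlMl// invf_div; have -> : b / a * s = s / a * b by ring.
have b0 : 0 <= b.
  apply: le_trans (qp 0 _); first by rewrite -(scale0r (0 : V)) pZ normr0 mul0r.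
  by rewrite -(scale0r (0 : V)) qZ normr0 mul0r.
have ba0 : 0 <= b / a by rewrite divr_ge0// ltW.
apply/ler_addgt0Pr => e e0; have d0 : 0 < e / (b / a + 1).
  by rewrite divr_gt0// ltr_pwDr.
apply: le_trans (key (q x + e / (b / a + 1)) _) _; first by rewrite ltrDl.
rewrite mulrDr lerD2l mulrCA ler_piMr ?(ltW e0)//.
by rewrite ler_pdivrMr ?mul1r ?lerDl// ltr_pwDr.
Qed.

Lemma restr_mono k l (f : C_line R) : (k <= l)%N ->
  `|restr k f| <= `|restr l f|.
Proof.
move=> kl; apply/restr_leP => x xk; have /restr_leP := lexx `|restr l f|.
by apply; apply: le_trans xk _; rewrite ler_nat.
Qed.

(** These sets shrink as [k] grows, hence generate a filter, and this filter
    converges to 0. *)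
Lemma C_line_nbhs0_restr (U : set (C_line R)) : nbhs (0 : C_line R) U ->
  exists k, forall f, `|restr k f| < k.+1%:R^-1 -> U f.
Proof.
pose B k := [set f : C_line R | `|restr k f| < k.+1%:R^-1].
have Bmono k l : (k <= l)%N -> B l `<=` B k.
  move=> kl f /= fl; apply: le_lt_trans (restr_mono f kl) _.
  by apply: lt_le_trans fl _; rewrite lef_pV2 ?posrE// ler_nat.
pose G := filter_from [set: nat] B.
have FG : Filter G.
  apply: filter_from_filter; first by exists 0%N.
  move=> k l _ _; exists (maxn k l) => // f Bf.
  by split; apply: Bmono Bf; rewrite ?leq_maxl ?leq_maxr.
have G0 : G --> (0 : C_line R).
  apply: C_line_cvg0 => k; apply/cvgrPdist_le => e e0.
  have [N Ne] : exists N : nat, N.+1%:R^-1 <= e.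
    exists (Num.truncn e^-1); rewrite invf_ple ?posrE//.
    by apply: ltW; exact: truncnS_gt.
  exists (maxn k N) => // f Bf; rewrite /= sub0r normrN.
  apply: le_trans (restr_mono f (leq_maxl k N)) _; apply: le_trans (ltW Bf) _.
  apply: le_trans Ne; rewrite lef_pV2 ?posrE// ler_nat ltnS; exact: leq_maxr.
by move=> /G0[k _ kU]; exists k => f /kU.
Qed.

Lemma restr_nbhs0 m (e : R) : 0 < e ->
  nbhs (0 : C_line R) [set f | `|restr m f| < e].
Proof.
move=> e0; have FF : Filter (nbhs (0 : C_line R)) := nbhs_filter _.
have /cvgrPdist_lt/(_ e e0) := @restr_continuous R m 0.
by apply: (@filterS _ _ FF) => f; rewrite linear0 sub0r normrN.
Qed.

(** The unit ball of [N] contains a neighbourhood given by a single segment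
    [-k, k], so [N] is dominated by the supremum over it; conversely each
    supremum over a segment is continuous, hence dominated by [N]. *)
Lemma normable_segment X (N : vnorm (csub X)) : norm_generates N ->
  exists k, segment_normed k X.
Proof.
move=> gN.
have valc : continuous (val : csub X -> C_line R) by exact: initial_continuous.
have ball0 : nbhs (0 : csub X) [set x | N x < 1].
  by apply/gN/normed_by_nbhs0; exists 1.
have [W [[V oV <-] /= V0 VN]] := ball0.
have {}V0 : nbhs (0 : C_line R) V by exact: open_nbhs_nbhs.
have [k kV] := C_line_nbhs0_restr V0.
have rZ m (t : R) (x : csub X) : `|restr m (val (t *: x))| =
    `|t| * `|restr m (val x)|.
  have -> : val (t *: x) = t *: val x by [].
  by rewrite linearZ normrZ.
have Nk x : N x <= 1 / k.+1%:R^-1 * `|restr k (val x)|.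
  apply: (seminorm_le (@vnormZ _ _ N) (rZ k)) => // y yk.
  by apply: ltW; apply: VN; exact: kV.
exists k => m.
have /gN/normed_by_nbhs0[d d0 dm] :
    nbhs (0 : csub X) [set x | `|restr m (val x)| < 1].
  exact: (valc (0 : csub X) _ (restr_nbhs0 m ltr01)).
have mN x : `|restr m (val x)| <= 1 / d * N x.
  apply: (seminorm_le (rZ m) (@vnormZ _ _ N)) => // [y|y /dm/ltW//].
  exact: (@normr_ge0 _ (normed_by N)).
exists (Num.truncn (1 / d * (1 / k.+1%:R^-1))).+1 => f Xf.
pose x : csub X := Sub f (mem_set Xf).
apply: le_trans (mN x) _; apply: le_trans (ler_wpM2l _ (Nk x)) _.
  by rewrite divr_ge0// ltW.
rewrite [leLHS]mulrA; apply: (@ler_wpM2r _ `|restr k f|) => //.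
by apply: ltW; exact: truncnS_gt.
Qed.

(** The normable subspaces sorted by the least [k] that works. *)
Definition normable_piece := seqDU segment_normed.

Lemma measurable_normable_piece k : measurable (normable_piece k).
Proof.
apply: measurableD; first exact: measurable_segment_normed.
by apply: bigsetU_measurable => i _; exact: measurable_segment_normed.
Qed.

(** Only the values on normable subspaces matter; [restr 0] serves as a Borel
    default elsewhere. *)
Definition to_SB X : SB R :=
  if pselect (exists k, normable_piece k X) is left e
  then push (restr (projT1 (cid e))) X else push (restr 0) X.

(** By [normable_segment] and [to_SB_isomorphic] this is normability. *)
Definition normable : set (SF R) := \bigcup_k segment_normed k.

Lemma normableE : normable = \bigcup_k normable_piece k.
Proof. exact: seqDU_bigcup_eq. Qed.

Lemma measurable_normable : measurable normable.
Proof. by apply: bigcupT_measurable; exact: measurable_segment_normed. Qed.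

Lemma measurable_push_restr k :
  measurable_fun [set: SF R] (push (restr k)).
Proof. by apply: measurable_push; exact: restr_continuous. Qed.

Lemma to_SBE k X : normable_piece k X -> to_SB X = push (restr k) X.
Proof.
move=> kX; rewrite /to_SB; case: pselect => [e|[]]; last by exists k.
by case: cid => l /= lX; congr (push (restr _) _);
  apply: (@trivIset_seqDU _ segment_normed l k I I); exists X.
Qed.

Lemma to_SBN X : ~ normable X -> to_SB X = push (restr 0) X.
Proof.
move=> nX; rewrite /to_SB; case: pselect => // -[k kX].
by case: nX; rewrite normableE; exists k.
Qed.

Lemma measurable_to_SB : measurable_fun [set: SF R] to_SB.
Proof.
rewrite -(setUv normable) measurable_funU; last 2 first.
- exact: measurable_normable.
- by apply: measurableC; exact: measurable_normable.
split.
  rewrite normableE measurable_fun_bigcup; last exact: measurable_normable_piece.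
  move=> k; apply: (eq_measurable_fun (push (restr k))).
    by move=> X /set_mem/to_SBE ->.
  exact: measurable_funTS (measurable_push_restr k).
apply: (eq_measurable_fun (push (restr 0))).
  by move=> X /set_mem/to_SBN ->.
exact: measurable_funTS (measurable_push_restr 0).
Qed.

Lemma to_SB_isomorphic X : normable X -> isomorphic (csub X) (csub (to_SB X)).
Proof.
rewrite normableE => -[k _ kX]; rewrite (to_SBE kX).
apply: push_isomorphic.
- exact: restr_continuous.
- exact: C_line_complete.
- exact: C_line_hausdorff.
- exact: norm_hausdorff.
- by apply: restr_bounded_below; case: kX.
Qed.

End Normable.

(** * The projective hierarchy *)

Section Projective.

(** A projection pulls back along [f] to the projection of the preimage under
    [f] times the identity of the Baire space. *)
Lemma Sigma1_preimage n d d' (T : measurableType d) (T' : measurableType d')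
    (f : T -> T') (A : set T') :
  measurable_fun [set: T] f -> Sigma1 n A -> Sigma1 n (f @^-1` A).
Proof.
elim: n d d' T T' f A => [|n IH] d d' T T' f A mf /=.
  by move=> mA; rewrite -[_ @^-1` _]setTI; exact: mf.
move=> [B sB ->]; pose F (p : T * baire_borel) := (f p.1, p.2).
exists (F @^-1` B).
  rewrite preimage_setC; apply: IH sB; apply: measurable_fun_pair => //.
  exact: measurableT_comp.
apply/seteqP; split=> [x [[y b] /= Byb yx]|x [[y b] /= Byb <-]].
  by exists (x, b) => //; rewrite /F /= -yx.
by exists (f y, b).
Qed.

(** Intersection and union are proved together because each step of the hierarchy
    passes to complements, which exchanges them. *)
Lemma Sigma1_measurable n d (T : measurableType d) (A D : set T) :
  measurable D -> Sigma1 n A -> Sigma1 n (A `&` D) /\ Sigma1 n (A `|` D).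
Proof.
elim: n d T A D => [|n IH] d T A D mD /=.
  by move=> mA; split; [exact: measurableI|exact: measurableU].
move=> [B sB ->]; pose E : set (T * baire_borel) := fst @^-1` D.
have mE : measurable E.
  by rewrite -[E]setTI; exact: measurable_fst.
have [sI sU] := IH _ _ _ _ (measurableC mE) sB.
split.
  exists (B `&` E); first by rewrite setCI.
  apply/seteqP; split=> [x [[[y b] /= Byb <-] Dy]|x [[y b] /= [Byb Dy] <-]].
    by exists (y, b).
  by split=> //; exists (y, b).
exists (B `|` E); first by rewrite setCU.
apply/seteqP; split=> [x [[[y b] /= Byb <-]|Dx]|x [[y b] /= [Byb|Dy] <-]].
- by exists (y, b) => //; left.
- by exists (x, point) => //; right.
- by left; exists (y, b).
- by right.
Qed.

Lemma Pi1_preimage n d d' (T : measurableType d) (T' : measurableType d')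
    (f : T -> T') (A : set T') :
  measurable_fun [set: T] f -> Pi1 n A -> Pi1 n (f @^-1` A).
Proof. by move=> mf; rewrite /Pi1 preimage_setC; exact: Sigma1_preimage. Qed.

Lemma Pi1_measurableI n d (T : measurableType d) (A D : set T) :
  measurable D -> Pi1 n A -> Pi1 n (A `&` D).
Proof.
move=> mD sA; rewrite /Pi1 setCI.
by have [] := Sigma1_measurable (measurableC mD) sA.
Qed.

End Projective.

(** * The reduction *)

Section Classes.
Context {R : realType}.

Lemma class_SF_to_SB (P : completeNormedModType R -> Prop) : banach_class P ->
  class_SF P = to_SB @^-1` class_SB P `&` normable.
Proof.
move=> bP; apply/seteqP; split=> X.
  move=> cX; have [N [gN _]] := cX; have [k kX] := normable_segment gN.
  have nX : normable X by exists k.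
  by split=> //; apply/(class_SF_isomorphic bP (to_SB_isomorphic nX)).
by move=> [cX nX]; apply/(class_SF_isomorphic bP (to_SB_isomorphic nX)).
Qed.

Lemma class_SB_to_SF (P : completeNormedModType R -> Prop) : banach_class P ->
  class_SB P = to_SF @^-1` class_SF P.
Proof.
move=> bP; apply/funext => X; apply/propext; apply: iff_sym.
exact: class_SF_isomorphic bP (to_SF_isomorphic X).
Qed.

End Classes.

Theorem theorem3p5 (R : realType) :
  (exists Psi : SB R -> SF R,
     [/\ measurable_fun [set: SB R] Psi, injective Psi &
         forall X : SB R, isomorphic (csub (Psi X)) (csub X)]) /\
  (forall P : completeNormedModType R -> Prop, banach_class P ->
     forall n : nat, (0 < n)%N ->
     [/\ Sigma1 n (class_SB P) <-> Sigma1 n (class_SF P),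
         Pi1 n (class_SB P) <-> Pi1 n (class_SF P) &
         Delta1 n (class_SB P) <-> Delta1 n (class_SF P)]).
Proof.
split.
  exists to_SF; split; first exact: measurable_to_SF.
    exact: to_SF_inj.
  exact: to_SF_isomorphic.
move=> P bP n _.
have S : Sigma1 n (class_SB P) <-> Sigma1 n (class_SF P).
  split=> sP; last first.
    by rewrite (class_SB_to_SF bP); exact: Sigma1_preimage measurable_to_SF sP.
  rewrite (class_SF_to_SB bP).
  have := Sigma1_measurable measurable_normable
    (Sigma1_preimage measurable_to_SB sP).
  by case.
have Q : Pi1 n (class_SB P) <-> Pi1 n (class_SF P).
  split=> sP; last first.
    by rewrite (class_SB_to_SF bP); exact: Pi1_preimage measurable_to_SF sP.
  rewrite (class_SF_to_SB bP); apply: Pi1_measurableI measurable_normable _.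
  exact: Pi1_preimage measurable_to_SB sP.
by split=> //; rewrite /Delta1 S Q.
Qed.
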